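(* If a sequent $\alpha\vdash\beta$ is valid in the class of all contextual dBas, then it is provable in $\mathbf{CDBL}$.
   Context: **Double Boolean algebras.** A double Boolean algebra (dBa) is an algebra $\mathbf{D}=(D,\sqcup,\sqcap,\neg,\lrcorner,\top,\bot)$ such that, writing $x\vee y:=\neg(\neg x\sqcap\neg y)$ and $x\wedge y:=\lrcorner(\lrcorner x\sqcup\lrcorner y)$, for all $x,y,z\in D$: (1a) $(x\sqcap x)\sqcap y=x\sqcap y$; (1b) $(x\sqcup x)\sqcup y=x\sqcup y$; (2a) $x\sqcap y=y\sqcap x$; (2b) $x\sqcup y=y\sqcup x$; (3a) $x\sqcap(y\sqcap z)=(x\sqcap y)\sqcap z$; (3b) $x\sqcup(y\sqcup z)=(x\sqcup y)\sqcup z$; (4a) $\neg(x\sqcap x)=\neg x$; (4b) $\lrcorner(x\sqcup x)=\lrcorner x$; (5a) $x\sqcap(x\sqcup y)=x\sqcap x$; (5b) $x\sqcup(x\sqcap y)=x\sqcup x$; (6a) $x\sqcap(y\vee z)=(x\sqcap y)\vee(x\sqcap z)$; (6b) $x\sqcup(y\wedge z)=(x\sqcup y)\wedge(x\sqcup z)$; (7a) $x\sqcap(x\vee y)=x\sqcap x$; (7b) $x\sqcup(x\wedge y)=x\sqcup x$; (8a) $\neg\neg(x\sqcap y)=x\sqcap y$; (8b) $\lrcorner\lrcorner(x\sqcup y)=x\sqcup y$; (9a) $x\sqcap\neg x=\bot$; (9b) $x\sqcup\lrcorner x=\top$; (10a) $\neg\bot=\top\sqcap\top$; (10b) $\lrcorner\top=\bot\sqcup\bot$;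 (11a) $\neg\top=\bot$; (11b) $\lrcorner\bot=\top$; (12) $(x\sqcap x)\sqcup(x\sqcap x)=(x\sqcup x)\sqcap(x\sqcup x)$. The quasi-order is: $x\sqsubseteq y$ iff $x\sqcap y=x\sqcap x$ and $x\sqcup y=y\sqcup y$. $\mathbf{D}$ is contextual if $\sqsubseteq$ is a partial order. **The logic CDBL.** Formulae (set $\mathfrak{F}$) are generated from a countably infinite set $\mathbf{PV}$ of propositional variables and constants $\top,\bot$ by binary connectives $\sqcup,\sqcap$ and unary connectives $\neg,\lrcorner$. Abbreviations: $\alpha\vee\beta:=\neg(\neg\alpha\sqcap\neg\beta)$, $\alpha\wedge\beta:=\lrcorner(\lrcorner\alpha\sqcup\lrcorner\beta)$. A sequent is a pair of formulae, written $\alpha\vdash\beta$; $\alpha\dashv\vdash\beta$ stands for both $\alpha\vdash\beta$ and $\beta\vdash\alpha$. Axiom schemata: (1) $\alpha\vdash\alpha$; (2a) $\alpha\sqcap\beta\vdash\alpha$; (2b) $\alpha\vdash\alpha\sqcup\beta$; (3a) $\alpha\sqcap\beta\vdash\beta$; (3b) $\beta\vdash\alpha\sqcup\beta$; (4a) $\alpha\sqcap\beta\vdash(\alpha\sqcap\beta)\sqcap(\alpha\sqcap\beta)$; (4b) $(\alpha\sqcup\beta)\sqcup(\alpha\sqcup\beta)\vdash\alpha\sqcup\beta$; (5a) $\neg(\alpha\sqcap\alpha)\vdash\neg\alpha$; (5b) $\lrcorner\alpha\vdash\lrcorner(\alpha\sqcup\alpha)$; (6a) $\alpha\sqcap\neg\alpha\vdash\bot$;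 (6b) $\top\vdash\alpha\sqcup\lrcorner\alpha$; (7a) $\neg\neg(\alpha\sqcap\beta)\dashv\vdash\alpha\sqcap\beta$; (7b) $\lrcorner\lrcorner(\alpha\sqcup\beta)\dashv\vdash\alpha\sqcup\beta$; (8a) $\alpha\sqcap\alpha\vdash\alpha\sqcap(\alpha\sqcup\beta)$; (8b) $\alpha\sqcup(\alpha\sqcap\beta)\vdash\alpha\sqcup\alpha$; (9a) $\alpha\sqcap\alpha\vdash\alpha\sqcap(\alpha\vee\beta)$; (9b) $\alpha\sqcup(\alpha\wedge\beta)\vdash\alpha\sqcup\alpha$; (10a) $\alpha\sqcap(\beta\vee\gamma)\dashv\vdash(\alpha\sqcap\beta)\vee(\alpha\sqcap\gamma)$; (10b) $\alpha\sqcup(\beta\wedge\gamma)\dashv\vdash(\alpha\sqcup\beta)\wedge(\alpha\sqcup\gamma)$; (11a) $\bot\vdash\alpha$; (11b) $\alpha\vdash\top$; (12a) $\neg\top\vdash\bot$; (12b) $\top\vdash\lrcorner\bot$; (13a) $\neg\bot\dashv\vdash\top\sqcap\top$; (13b) $\lrcorner\top\dashv\vdash\bot\sqcup\bot$; (14) $(\alpha\sqcup\alpha)\sqcap(\alpha\sqcup\alpha)\dashv\vdash(\alpha\sqcap\alpha)\sqcup(\alpha\sqcap\alpha)$. Rules: from $\alpha\vdash\beta$ infer (R1) $\alpha\sqcap\gamma\vdash\beta\sqcap\gamma$, (R1)$'$ $\gamma\sqcap\alpha\vdash\gamma\sqcap\beta$, (R2) $\alpha\sqcup\gamma\vdash\beta\sqcup\gamma$,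 (R2)$'$ $\gamma\sqcup\alpha\vdash\gamma\sqcup\beta$, (R3) $\neg\beta\vdash\neg\alpha$, (R3)$'$ $\lrcorner\beta\vdash\lrcorner\alpha$; (R4) from $\alpha\vdash\beta$ and $\beta\vdash\gamma$ infer $\alpha\vdash\gamma$; (R5) from $\alpha\sqcap\beta\vdash\alpha\sqcap\alpha$, $\alpha\sqcap\alpha\vdash\alpha\sqcap\beta$, $\alpha\sqcup\beta\vdash\beta\sqcup\beta$ and $\beta\sqcup\beta\vdash\alpha\sqcup\beta$ infer $\alpha\vdash\beta$. A sequent is provable if it is the last member of a finite sequence of sequents, each an axiom or obtained from earlier ones by a rule. **Validity.** A valuation on a contextual dBa $\mathbf{D}$ is a map $v:\mathfrak{F}\to D$ commuting with $\sqcup,\sqcap,\neg,\lrcorner$ and sending $\top,\bot$ to $\top_D,\bot_D$. $v$ satisfies $\alpha\vdash\beta$ iff $v(\alpha)\sqsubseteq v(\beta)$. $\alpha\vdash\beta$ is true in $\mathbf{D}$ iff every valuation on $\mathbf{D}$ satisfies it, and valid in a class iff true in every member. *)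

(* Defs.v *)
From Stdlib Require Import List Relation_Definitions.
Import ListNotations.

Set Implicit Arguments.
Unset Strict Implicit.

Reserved Notation "¬ x" (at level 35, right associativity).
Reserved Notation "⌟ x" (at level 35, right associativity).
Reserved Notation "x ⊓ y" (at level 50, no associativity).
Reserved Notation "x ⊔ y" (at level 50, no associativity).
Reserved Notation "x ∨ y" (at level 50, no associativity).
Reserved Notation "x ∧ y" (at level 50, no associativity).
Reserved Notation "x ⊑ y" (at level 70, no associativity).
Reserved Notation "x ⊢ y" (at level 70, no associativity).

Declare Scope dba_scope.
Declare Scope formula_scope.
Delimit Scope dba_scope with dba.
Delimit Scope formula_scope with F.

Record dba_sig : Type := Dba_sig {
  carrier :> Type;
  dmeet : carrier -> carrier -> carrier;
  djoin : carrier -> carrier -> carrier;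
  dneg : carrier -> carrier;
  dopp : carrier -> carrier;
  dtop : carrier;
  dbot : carrier
}.
Arguments dtop {_}.
Arguments dbot {_}.
Bind Scope dba_scope with carrier.

Notation "x ⊓ y" := (dmeet x y) : dba_scope.
Notation "x ⊔ y" := (djoin x y) : dba_scope.
Notation "¬ x" := (dneg x) : dba_scope.
Notation "⌟ x" := (dopp x) : dba_scope.
Notation "⊤" := dtop : dba_scope.
Notation "⊥" := dbot : dba_scope.

Local Open Scope dba_scope.

Definition dvee (A : dba_sig) (x y : A) : A := ¬ (¬ x ⊓ ¬ y).
Definition dwedge (A : dba_sig) (x y : A) : A := ⌟ (⌟ x ⊔ ⌟ y).
Notation "x ∨ y" := (dvee x y) : dba_scope.
Notation "x ∧ y" := (dwedge x y) : dba_scope.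

Record dBa : Type := DBa {
  dBa_sig :> dba_sig;
  dba1a : forall x y : dBa_sig, (x ⊓ x) ⊓ y = x ⊓ y;
  dba1b : forall x y : dBa_sig, (x ⊔ x) ⊔ y = x ⊔ y;
  dba2a : forall x y : dBa_sig, x ⊓ y = y ⊓ x;
  dba2b : forall x y : dBa_sig, x ⊔ y = y ⊔ x;
  dba3a : forall x y z : dBa_sig, x ⊓ (y ⊓ z) = (x ⊓ y) ⊓ z;
  dba3b : forall x y z : dBa_sig, x ⊔ (y ⊔ z) = (x ⊔ y) ⊔ z;
  dba4a : forall x : dBa_sig, ¬ (x ⊓ x) = ¬ x;
  dba4b : forall x : dBa_sig, ⌟ (x ⊔ x) = ⌟ x;
  dba5a : forall x y : dBa_sig, x ⊓ (x ⊔ y) = x ⊓ x;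
  dba5b : forall x y : dBa_sig, x ⊔ (x ⊓ y) = x ⊔ x;
  dba6a : forall x y z : dBa_sig, x ⊓ (y ∨ z) = (x ⊓ y) ∨ (x ⊓ z);
  dba6b : forall x y z : dBa_sig, x ⊔ (y ∧ z) = (x ⊔ y) ∧ (x ⊔ z);
  dba7a : forall x y : dBa_sig, x ⊓ (x ∨ y) = x ⊓ x;
  dba7b : forall x y : dBa_sig, x ⊔ (x ∧ y) = x ⊔ x;
  dba8a : forall x y : dBa_sig, ¬ ¬ (x ⊓ y) = x ⊓ y;
  dba8b : forall x y : dBa_sig, ⌟ ⌟ (x ⊔ y) = x ⊔ y;
  dba9a : forall x : dBa_sig, x ⊓ ¬ x = ⊥;
  dba9b : forall x : dBa_sig, x ⊔ ⌟ x = ⊤;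
  dba10a : ¬ ⊥ = ⊤ ⊓ ⊤ :> dBa_sig;
  dba10b : ⌟ ⊤ = ⊥ ⊔ ⊥ :> dBa_sig;
  dba11a : ¬ ⊤ = ⊥ :> dBa_sig;
  dba11b : ⌟ ⊥ = ⊤ :> dBa_sig;
  dba12 : forall x : dBa_sig, (x ⊓ x) ⊔ (x ⊓ x) = (x ⊔ x) ⊓ (x ⊔ x)
}.

Definition dle (D : dBa) (x y : D) : Prop := x ⊓ y = x ⊓ x /\ x ⊔ y = y ⊔ y.
Notation "x ⊑ y" := (dle x y) : dba_scope.

Definition contextual (D : dBa) : Prop := order D (@dle D).

Local Close Scope dba_scope.

(* Propositional variables are indexed by [nat]. *)
Inductive formula : Type :=
| PVar (p : nat)
| FTop
| FBot
| FJoin (α β : formula)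
| FMeet (α β : formula)
| FNeg (α : formula)
| FOpp (α : formula).
Bind Scope formula_scope with formula.

Notation "x ⊓ y" := (FMeet x y) : formula_scope.
Notation "x ⊔ y" := (FJoin x y) : formula_scope.
Notation "¬ x" := (FNeg x) : formula_scope.
Notation "⌟ x" := (FOpp x) : formula_scope.
Notation "⊤" := FTop : formula_scope.
Notation "⊥" := FBot : formula_scope.

Local Open Scope formula_scope.

Definition FVee (α β : formula) : formula := ¬ (¬ α ⊓ ¬ β).
Definition FWedge (α β : formula) : formula := ⌟ (⌟ α ⊔ ⌟ β).
Notation "x ∨ y" := (FVee x y) : formula_scope.
Notation "x ∧ y" := (FWedge x y) : formula_scope.

Definition sequent : Type := (formula * formula)%type.
Notation "α ⊢ β" := (@pair formula formula α β) : formula_scope.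

(* A schema [α ⊣⊢ β] gives two constructors, suffixed [_lr] and [_rl]. *)
Inductive axiom : sequent -> Prop :=
| ax1 α : axiom (α ⊢ α)
| ax2a α β : axiom (α ⊓ β ⊢ α)
| ax2b α β : axiom (α ⊢ α ⊔ β)
| ax3a α β : axiom (α ⊓ β ⊢ β)
| ax3b α β : axiom (β ⊢ α ⊔ β)
| ax4a α β : axiom (α ⊓ β ⊢ (α ⊓ β) ⊓ (α ⊓ β))
| ax4b α β : axiom ((α ⊔ β) ⊔ (α ⊔ β) ⊢ α ⊔ β)
| ax5a α : axiom (¬ (α ⊓ α) ⊢ ¬ α)
| ax5b α : axiom (⌟ α ⊢ ⌟ (α ⊔ α))
| ax6a α : axiom (α ⊓ ¬ α ⊢ ⊥)
| ax6b α : axiom (⊤ ⊢ α ⊔ ⌟ α)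
| ax7a_lr α β : axiom (¬ ¬ (α ⊓ β) ⊢ α ⊓ β)
| ax7a_rl α β : axiom (α ⊓ β ⊢ ¬ ¬ (α ⊓ β))
| ax7b_lr α β : axiom (⌟ ⌟ (α ⊔ β) ⊢ α ⊔ β)
| ax7b_rl α β : axiom (α ⊔ β ⊢ ⌟ ⌟ (α ⊔ β))
| ax8a α β : axiom (α ⊓ α ⊢ α ⊓ (α ⊔ β))
| ax8b α β : axiom (α ⊔ (α ⊓ β) ⊢ α ⊔ α)
| ax9a α β : axiom (α ⊓ α ⊢ α ⊓ (α ∨ β))
| ax9b α β : axiom (α ⊔ (α ∧ β) ⊢ α ⊔ α)
| ax10a_lr α β γ : axiom (α ⊓ (β ∨ γ) ⊢ (α ⊓ β) ∨ (α ⊓ γ))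
| ax10a_rl α β γ : axiom ((α ⊓ β) ∨ (α ⊓ γ) ⊢ α ⊓ (β ∨ γ))
| ax10b_lr α β γ : axiom (α ⊔ (β ∧ γ) ⊢ (α ⊔ β) ∧ (α ⊔ γ))
| ax10b_rl α β γ : axiom ((α ⊔ β) ∧ (α ⊔ γ) ⊢ α ⊔ (β ∧ γ))
| ax11a α : axiom (⊥ ⊢ α)
| ax11b α : axiom (α ⊢ ⊤)
| ax12a : axiom (¬ ⊤ ⊢ ⊥)
| ax12b : axiom (⊤ ⊢ ⌟ ⊥)
| ax13a_lr : axiom (¬ ⊥ ⊢ ⊤ ⊓ ⊤)
| ax13a_rl : axiom (⊤ ⊓ ⊤ ⊢ ¬ ⊥)
| ax13b_lr : axiom (⌟ ⊤ ⊢ ⊥ ⊔ ⊥)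
| ax13b_rl : axiom (⊥ ⊔ ⊥ ⊢ ⌟ ⊤)
| ax14_lr α : axiom ((α ⊔ α) ⊓ (α ⊔ α) ⊢ (α ⊓ α) ⊔ (α ⊓ α))
| ax14_rl α : axiom ((α ⊓ α) ⊔ (α ⊓ α) ⊢ (α ⊔ α) ⊓ (α ⊔ α)).

(* [rule ps s]: the sequent [s] follows in one step from the premises [ps]. *)
Inductive rule : list sequent -> sequent -> Prop :=
| R1 α β γ : rule [α ⊢ β] (α ⊓ γ ⊢ β ⊓ γ)
| R1' α β γ : rule [α ⊢ β] (γ ⊓ α ⊢ γ ⊓ β)
| R2 α β γ : rule [α ⊢ β] (α ⊔ γ ⊢ β ⊔ γ)
| R2' α β γ : rule [α ⊢ β] (γ ⊔ α ⊢ γ ⊔ β)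
| R3 α β : rule [α ⊢ β] (¬ β ⊢ ¬ α)
| R3' α β : rule [α ⊢ β] (⌟ β ⊢ ⌟ α)
| R4 α β γ : rule [α ⊢ β; β ⊢ γ] (α ⊢ γ)
| R5 α β :
    rule [α ⊓ β ⊢ α ⊓ α; α ⊓ α ⊢ α ⊓ β; α ⊔ β ⊢ β ⊔ β; β ⊔ β ⊢ α ⊔ β]
      (α ⊢ β).

Definition is_proof (l : list sequent) : Prop :=
  forall (l1 l2 : list sequent) (s : sequent), l = l1 ++ s :: l2 ->
    axiom s \/ exists ps, rule ps s /\ incl ps l1.

Definition provable (s : sequent) : Prop := exists l, is_proof (l ++ [s]).

Record valuation (D : dBa) : Type := Valuation {
  val_fun :> formula -> D;
  val_join : forall α β, val_fun (α ⊔ β) = (val_fun α ⊔ val_fun β)%dba;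
  val_meet : forall α β, val_fun (α ⊓ β) = (val_fun α ⊓ val_fun β)%dba;
  val_neg : forall α, val_fun (¬ α) = (¬ val_fun α)%dba;
  val_opp : forall α, val_fun (⌟ α) = (⌟ val_fun α)%dba;
  val_top : val_fun ⊤ = ⊤%dba;
  val_bot : val_fun ⊥ = ⊥%dba
}.

Definition satisfies (D : dBa) (v : valuation D) (s : sequent) : Prop :=
  (v (fst s) ⊑ v (snd s))%dba.

Definition true_in (D : dBa) (s : sequent) : Prop :=
  forall v : valuation D, satisfies v s.

Definition valid_in (K : dBa -> Prop) (s : sequent) : Prop :=
  forall D : dBa, K D -> true_in D s.

(* Main.v *)
From Stdlib Require Import List Relation_Definitions.
From Stdlib Require Import FunctionalExtensionality PropExtensionality.
From Stdlib Require Import ProofIrrelevance IndefiniteDescription.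
Require Import Defs.
Import ListNotations.

(** The proof evaluates the sequent in the Lindenbaum-Tarski algebra: formulae
    modulo interderivability [α ⊣⊢ β], with the operations induced by the
    connectives.  Rules (R1)-(R3)' make interderivability a congruence, so these
    operations are well defined, and the map [cls] sending a formula to its class
    is a valuation.

    This algebra is a dBa.  An identity amounts to two entailments, and the ones
    that are not axiom schemata come from monotonicity of the connectives together
    with one fact about ⊓ and its dual about ⊔.  In general [γ ⊢ α] and [γ ⊢ β]
    yield only [γ ⊓ γ ⊢ α ⊓ β], since [γ] need not entail [γ ⊓ γ].  But when [γ] is
    itself a meet, schema (4a) supplies that entailment, so among meets ⊓ is a
    genuine greatest lower bound ([meet_intro], [join_elim]).  Commutativity,
    associativity and the converses of the absorption schemata (8) and (9) are
    entailments of this kind.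

    The decisive point is [cls_le]: [cls α ⊑ cls β] holds exactly when [α ⊢ β] is
    provable.  The four premises of (R5) spell out [cls α ⊑ cls β], so
    (R5) is one direction.  Hence ⊑ inherits reflexivity, transitivity and
    antisymmetry from provability, the algebra is contextual, and a valid
    sequent, being satisfied by [cls], is provable. *)

Local Open Scope formula_scope.

(** * Closure of provability under axioms and rules *)

Lemma is_proof_app (l1 l2 : list sequent) :
  is_proof l1 -> is_proof l2 -> is_proof (l1 ++ l2).
Proof.
  intros H1 H2 k1 k2 s E.
  apply app_eq_app in E as [m [[-> E] | [-> E]]].
  - destruct m as [|t m]; simpl in E.
    + destruct (H2 [] k2 s (eq_sym E)) as [A | [ps [R I]]]; [now left | right].
      exists ps; split; [exact R|].
      intros x Hx; destruct (I x Hx).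
    + injection E as <- ->. exact (H1 k1 m s eq_refl).
  - destruct (H2 m k2 s E) as [A | [ps [R I]]]; [now left | right].
    exists ps; split; [exact R | now apply incl_appr].
Qed.

Lemma is_proof_snoc (l : list sequent) (s : sequent) :
  is_proof l -> (axiom s \/ exists ps, rule ps s /\ incl ps l) ->
  is_proof (l ++ [s]).
Proof.
  intros H J k1 k2 t E.
  destruct k2 as [|u k2 _] using rev_ind.
  - apply app_inj_tail in E as [-> ->]. exact J.
  - rewrite app_comm_cons, app_assoc in E.
    apply app_inj_tail in E as [E _]. exact (H k1 k2 t E).
Qed.

Lemma provable_axiom (s : sequent) : axiom s -> provable s.
Proof.
  intros A. exists []. apply is_proof_snoc; [|now left].
  intros l1 l2 t E. now apply app_cons_not_nil in E.
Qed.

Lemma joint_proof (ps : list sequent) :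
  Forall provable ps -> exists l, is_proof l /\ incl ps l.
Proof.
  induction 1 as [|s ps [l Hl] _ [m [Hm I]]].
  - exists []. split; [|apply incl_refl].
    intros l1 l2 t E. now apply app_cons_not_nil in E.
  - exists ((l ++ [s]) ++ m). split; [now apply is_proof_app|].
    apply incl_cons; [|now apply incl_appr].
    apply in_or_app; left; apply in_elt.
Qed.

Lemma provable_rule (ps : list sequent) (s : sequent) :
  rule ps s -> Forall provable ps -> provable s.
Proof.
  intros R Hps. destruct (joint_proof ps Hps) as [l [Hl I]].
  exists l. apply is_proof_snoc; [exact Hl | right; now exists ps].
Qed.

(** * Derived entailments *)

Lemma entails_trans (α β γ : formula) :
  provable (α ⊢ β) -> provable (β ⊢ γ) -> provable (α ⊢ γ).
Proof. intros; eapply provable_rule; [apply (@R4 α β γ) | auto]. Qed.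

Lemma meet_mono (α α' β β' : formula) :
  provable (α ⊢ α') -> provable (β ⊢ β') -> provable (α ⊓ β ⊢ α' ⊓ β').
Proof.
  intros Ha Hb. apply (entails_trans _ (α' ⊓ β)).
  - eapply provable_rule; [apply R1 | auto].
  - eapply provable_rule; [apply R1' | auto].
Qed.

Lemma join_mono (α α' β β' : formula) :
  provable (α ⊢ α') -> provable (β ⊢ β') -> provable (α ⊔ β ⊢ α' ⊔ β').
Proof.
  intros Ha Hb. apply (entails_trans _ (α' ⊔ β)).
  - eapply provable_rule; [apply R2 | auto].
  - eapply provable_rule; [apply R2' | auto].
Qed.

Lemma neg_anti (α β : formula) : provable (α ⊢ β) -> provable (¬ β ⊢ ¬ α).
Proof. intros; eapply provable_rule; [apply R3 | auto]. Qed.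

Lemma opp_anti (α β : formula) : provable (α ⊢ β) -> provable (⌟ β ⊢ ⌟ α).
Proof. intros; eapply provable_rule; [apply R3' | auto]. Qed.

(** The antecedent has to be a meet: schema (4a) then duplicates it, and each
    copy yields one conjunct. *)
Lemma meet_intro (α β γ δ : formula) :
  provable (α ⊓ β ⊢ γ) -> provable (α ⊓ β ⊢ δ) -> provable (α ⊓ β ⊢ γ ⊓ δ).
Proof.
  intros. apply (entails_trans _ ((α ⊓ β) ⊓ (α ⊓ β))).
  - apply provable_axiom, ax4a.
  - now apply meet_mono.
Qed.

(** Dual of [meet_intro]: the succedent has to be a join, by schema (4b). *)
Lemma join_elim (α β γ δ : formula) :
  provable (γ ⊢ α ⊔ β) -> provable (δ ⊢ α ⊔ β) -> provable (γ ⊔ δ ⊢ α ⊔ β).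
Proof.
  intros. apply (entails_trans _ ((α ⊔ β) ⊔ (α ⊔ β))).
  - now apply join_mono.
  - apply provable_axiom, ax4b.
Qed.

Lemma meet_elim_l (α β γ : formula) :
  provable (α ⊢ γ) -> provable (α ⊓ β ⊢ γ).
Proof. intros; eapply entails_trans; [apply provable_axiom, ax2a | auto]. Qed.

Lemma meet_elim_r (α β γ : formula) :
  provable (β ⊢ γ) -> provable (α ⊓ β ⊢ γ).
Proof. intros; eapply entails_trans; [apply provable_axiom, ax3a | auto]. Qed.

Lemma join_intro_l (α β γ : formula) :
  provable (γ ⊢ α) -> provable (γ ⊢ α ⊔ β).
Proof. intros; eapply entails_trans; [eauto | apply provable_axiom, ax2b]. Qed.

Lemma join_intro_r (α β γ : formula) :
  provable (γ ⊢ β) -> provable (γ ⊢ α ⊔ β).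
Proof. intros; eapply entails_trans; [eauto | apply provable_axiom, ax3b]. Qed.

Create HintDb cdbl.
#[local] Hint Constructors axiom : cdbl.
#[local] Hint Resolve provable_axiom neg_anti opp_anti meet_mono join_mono : cdbl.
#[local] Hint Resolve meet_intro join_elim meet_elim_l meet_elim_r
  join_intro_l join_intro_r : cdbl.

(** * Classes of interderivable formulae *)

Definition interderivable (α β : formula) : Prop :=
  provable (α ⊢ β) /\ provable (β ⊢ α).

Definition lt_carrier : Type :=
  {P : formula -> Prop | exists α, P = interderivable α}.

Definition lt_class (α : formula) : lt_carrier :=
  exist _ (interderivable α) (ex_intro _ α eq_refl).

Lemma lt_class_surj (x : lt_carrier) : exists α, x = lt_class α.
Proof.
  destruct x as [P [α ->]]. exists α. reflexivity.
Qed.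

Lemma lt_class_eq (α β : formula) :
  lt_class α = lt_class β <-> interderivable α β.
Proof.
  split.
  - intros E. apply (f_equal (@proj1_sig _ _)) in E. simpl in E. rewrite E.
    split; auto with cdbl.
  - intros [Hab Hba]. apply subset_eq_compat, functional_extensionality.
    intros γ. apply propositional_extensionality.
    split; intros [H H']; split; eauto using entails_trans.
Qed.

Definition lt_repr (x : lt_carrier) : formula :=
  proj1_sig (constructive_indefinite_description _ (lt_class_surj x)).

Lemma lt_repr_class (α : formula) : interderivable (lt_repr (lt_class α)) α.
Proof.
  apply lt_class_eq. symmetry. unfold lt_repr.
  exact (proj2_sig (constructive_indefinite_description _ (lt_class_surj _))).
Qed.

(** * The Lindenbaum-Tarski algebra *)

Definition lt_sig : dba_sig := {|
  carrier := lt_carrier;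
  dmeet x y := lt_class (lt_repr x ⊓ lt_repr y);
  djoin x y := lt_class (lt_repr x ⊔ lt_repr y);
  dneg x := lt_class (¬ lt_repr x);
  dopp x := lt_class (⌟ lt_repr x);
  dtop := lt_class ⊤;
  dbot := lt_class ⊥
|}.

(** [lt_class] with the algebra itself as codomain, so that the operations of
    [lt_sig] apply to its values. *)
Definition cls (α : formula) : lt_sig := lt_class α.

Lemma cls_surj (x : lt_sig) : exists α, x = cls α.
Proof. apply lt_class_surj. Qed.

Lemma cls_meet (α β : formula) : (cls α ⊓ cls β)%dba = cls (α ⊓ β).
Proof.
  apply lt_class_eq.
  destruct (lt_repr_class α), (lt_repr_class β); split; now apply meet_mono.
Qed.

Lemma cls_join (α β : formula) : (cls α ⊔ cls β)%dba = cls (α ⊔ β).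
Proof.
  apply lt_class_eq.
  destruct (lt_repr_class α), (lt_repr_class β); split; now apply join_mono.
Qed.

Lemma cls_neg (α : formula) : (¬ cls α)%dba = cls (¬ α).
Proof.
  apply lt_class_eq. destruct (lt_repr_class α); split; now apply neg_anti.
Qed.

Lemma cls_opp (α : formula) : (⌟ cls α)%dba = cls (⌟ α).
Proof.
  apply lt_class_eq. destruct (lt_repr_class α); split; now apply opp_anti.
Qed.

Lemma cls_vee (α β : formula) : (cls α ∨ cls β)%dba = cls (α ∨ β).
Proof. unfold dvee. now rewrite !cls_neg, cls_meet, cls_neg. Qed.

Lemma cls_wedge (α β : formula) : (cls α ∧ cls β)%dba = cls (α ∧ β).
Proof. unfold dwedge. now rewrite !cls_opp, cls_join, cls_opp. Qed.

(** Turns an identity of the algebra into the two entailments between formulae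
    that it stands for. *)
Ltac to_entailments :=
  intros;
  repeat match goal with
  | x : carrier lt_sig |- _ =>
      destruct (cls_surj x) as [? ->]
  end;
  change (@dtop lt_sig) with (cls ⊤); change (@dbot lt_sig) with (cls ⊥);
  repeat rewrite ?cls_vee, ?cls_wedge, ?cls_meet, ?cls_join, ?cls_neg, ?cls_opp;
  apply lt_class_eq; split.

Definition lt_algebra : dBa.
Proof.
  apply (@DBa lt_sig);
    to_entailments; auto 7 with cdbl.
Defined.

(** Left to right is (R5); right to left, [meet_intro] and [join_elim] apply
    because both sides of the first identity are meets and both sides of the
    second are joins. *)
Lemma cls_le (α β : formula) :
  @dle lt_algebra (cls α) (cls β) <-> provable (α ⊢ β).
Proof.
  unfold dle; simpl dBa_sig. rewrite !cls_meet, !cls_join.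
  split.
  - intros [[Hm Hm']%lt_class_eq [Hj Hj']%lt_class_eq].
    eapply provable_rule; [apply R5 | auto].
  - intros H. split; apply lt_class_eq; split; auto with cdbl.
Qed.

Lemma lt_algebra_contextual : contextual lt_algebra.
Proof.
  split.
  - intros x. now split.
  - intros x y z.
    destruct (cls_surj x) as [α ->], (cls_surj y) as [β ->],
      (cls_surj z) as [γ ->].
    rewrite !cls_le. apply entails_trans.
  - intros x y.
    destruct (cls_surj x) as [α ->], (cls_surj y) as [β ->].
    rewrite !cls_le. intros Hab Hba. now apply lt_class_eq.
Qed.

Definition canonical_valuation : valuation lt_algebra := {|
  val_fun := cls : formula -> lt_algebra;
  val_join α β := eq_sym (cls_join α β);
  val_meet α β := eq_sym (cls_meet α β);
  val_neg α := eq_sym (cls_neg α);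
  val_opp α := eq_sym (cls_opp α);
  val_top := eq_refl;
  val_bot := eq_refl
|}.

Theorem theorem29 (α β : formula) :
  valid_in contextual (α ⊢ β)%F -> provable (α ⊢ β)%F.
Proof.
  intros Hvalid. apply cls_le.
  exact (Hvalid lt_algebra lt_algebra_contextual canonical_valuation).
Qed.
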